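(* Let $g_n$ be the number of tilings of the honeycomb strip $H_n$ using monomers, slanted dimers and trimers (horizontal dimers not allowed), with $g_0=1$. Then for all $n\ge 0$, $g_n=T_{n+2}$, where $T_j$ are the tribonacci numbers.
   Context: The honeycomb strip $H_n$ consists of $n$ regular hexagons arranged in two rows, numbered $1,\dots,n$ from the bottom left so that odd-numbered hexagons form the bottom row and even-numbered ones the top row; hexagon $i$ shares an edge with hexagons $i\pm1$ and $i\pm2$. Here the allowed tiles are: monomers $\{i\}$, slanted dimers $\{i,i+1\}$, and trimers $\{i,i+1,i+2\}$ of three consecutively numbered hexagons; a tiling is a partition of the hexagons of $H_n$ into such tiles. Tribonacci numbers: $T_0=T_1=0$, $T_2=1$, $T_n=T_{n-1}+T_{n-2}+T_{n-3}$ for $n\ge3$. *)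

(* Defs.v *)
From mathcomp Require Import all_boot.

Set Implicit Arguments.
Unset Strict Implicit.
Unset Printing Implicit Defensive.

(* The hexagons of H_n are the elements of 'I_n: hexagon number k (1 <= k <= n)
   is the ordinal of value k - 1. *)

Definition monomer n (B : {set 'I_n}) : bool :=
  [exists i : 'I_n, B == [set i]].

Definition slanted_dimer n (B : {set 'I_n}) : bool :=
  [exists i : 'I_n, exists j : 'I_n,
    ((j : nat) == i.+1) && (B == [set i; j])].

Definition trimer n (B : {set 'I_n}) : bool :=
  [exists i : 'I_n, exists j : 'I_n, exists k : 'I_n,
    [&& (j : nat) == i.+1, (k : nat) == i.+2 & B == [set i; j; k]]].

Definition tile n (B : {set 'I_n}) : bool :=
  [|| monomer B, slanted_dimer B | trimer B].

Definition tiling n (P : {set {set 'I_n}}) : bool :=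
  partition P [set: 'I_n] && [forall B in P, tile B].

(* For n = 0 the empty partition is the only tiling, so num_tilings 0 = 1. *)
Definition num_tilings (n : nat) : nat := #|[set P : {set {set 'I_n}} | tiling P]|.

Fixpoint tribonacci (n : nat) : nat :=
  match n with
  | 0 | 1 => 0
  | 2 => 1
  | ((p.+1 as q).+1 as r).+1 => tribonacci r + tribonacci q + tribonacci p
  end.

(* Main.v *)
Require Import Defs.
From mathcomp Require Import all_boot.
From mathcomp Require Import zify.

Set Implicit Arguments.
Unset Strict Implicit.
Unset Printing Implicit Defensive.

(** The tile covering the last hexagon of H_m is one of the intervals of
    length 1, 2 or 3 ending there, and removing it is a bijection onto the
    tilings of the corresponding shorter strip. All the strips H_m with m <= n
    are kept inside 'I_n, as initial segments, so that the removal needs no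
    change of type. *)

Definition interval n (a b : nat) : {set 'I_n} := [set i : 'I_n | a <= i < b].

Definition prefix_tilings n (m : nat) : {set {set {set 'I_n}}} :=
  [set P | partition P (interval n 0 m) && [forall B in P, tile B]].

Lemma interval_neq0 n a b : a < b <= n -> interval n a b != set0.
Proof.
move=> /andP[ab bn]; apply/set0Pn.
by exists (Ordinal (leq_trans ab bn)); rewrite inE /= leqnn.
Qed.

(** The three shapes merge into one family indexed by the starting hexagon [a] and the length [d],
    so that later arguments are interval arithmetic. *)
Lemma tileP n (B : {set 'I_n}) :
  reflect (exists a d, [/\ 0 < d <= 3, a + d <= n & B = interval n a (a + d)])
          (tile B).
Proof.
apply: (iffP idP) => [/or3P[]|[a [d [d13 adn ->]]]].
- move=> /existsP[i /eqP->]; exists i, 1; split; rewrite ?addn1 //.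
  by apply/setP=> x; rewrite !inE -val_eqE /=; lia.
- move=> /existsP[i /existsP[j /andP[/eqP ji /eqP->]]].
  exists i, 2; split=> //; first by have := ltn_ord j; lia.
  by apply/setP=> x; rewrite !inE -!val_eqE /=; lia.
- move=> /existsP[i /existsP[j /existsP[k /and3P[/eqP ji /eqP ki /eqP->]]]].
  exists i, 3; split=> //; first by have := ltn_ord k; lia.
  by apply/setP=> x; rewrite !inE -!val_eqE /=; lia.
have lt0 : a < n by lia.
case: d d13 adn => [|[|[|[|d]]]] // _ adn; apply/or3P.
- apply: Or31; apply/existsP; exists (Ordinal lt0); apply/eqP/setP=> x.
  by rewrite !inE -val_eqE /=; lia.
- have lt1 : a.+1 < n by lia.
  apply: Or32; apply/existsP; exists (Ordinal lt0).
  apply/existsP; exists (Ordinal lt1); rewrite eqxx; apply/eqP/setP=> x.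
  by rewrite !inE -!val_eqE /=; lia.
have lt1 : a.+1 < n by lia.
have lt2 : a.+2 < n by lia.
apply: Or33; apply/existsP; exists (Ordinal lt0); apply/existsP.
exists (Ordinal lt1); apply/existsP; exists (Ordinal lt2); rewrite !eqxx.
by apply/eqP/setP=> x; rewrite !inE -!val_eqE /=; lia.
Qed.

Lemma card_prefix_tilings_last n m d : 0 < d <= 3 -> m + d <= n ->
  #|[set P in prefix_tilings n (m + d) | interval n m (m + d) \in P]|
    = #|prefix_tilings n m|.
Proof.
move=> d13 mdn; set B := interval n m (m + d).
have tB : tile B by apply/tileP; exists m, d.
have B0 : B != set0 by apply: interval_neq0; lia.
have dB : [disjoint B & interval n 0 m].
  by apply/pred0P=> x; rewrite !inE; lia.
have BU : B :|: interval n 0 m = interval n 0 (m + d).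
  by apply/setP=> x; rewrite !inE; lia.
have BD : interval n 0 (m + d) :\: B = interval n 0 m.
  by apply/setP=> x; rewrite !inE; lia.
(* As a block, [B] would lie inside the prefix it is disjoint from, hence be empty. So adding [B] is
   undone by removing it, which gives injectivity. *)
have BnP P : P \in prefix_tilings n m -> B \notin P.
  rewrite inE => /andP[pP _]; apply/negP=> BP.
  have sB : B \subset interval n 0 m.
    by rewrite -(cover_partition pP) (bigcup_max B).
  by case/negP: B0; rewrite -subset0 -(disjoint_setI0 dB) subsetI subxx.
have injU : {in prefix_tilings n m &, injective (fun P => B |: P)}.
  by move=> P Q /BnP BP /BnP BQ eqPQ; rewrite -(setU1K BP) eqPQ setU1K.
rewrite -(card_in_imset injU).
apply: eq_card => P; rewrite inE; apply/andP/imsetP => [[]|[Q QT ->]].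
  rewrite inE => /andP[pP /forall_inP tP] BP.
  exists (P :\ B); last by rewrite setD1K.
  rewrite inE -BD partitionD1 //=; apply/forall_inP=> C.
  by rewrite in_setD1 => /andP[_ /tP].
split; last exact: setU11.
move: QT; rewrite !inE -BU => /andP[pQ /forall_inP tQ].
by rewrite partitionU1 //=; apply/forall_inP=> C /setU1P[->|/tQ].
Qed.

(** The block containing the last hexagon, of value [m.-1], is unique and must end there. The bound
    [d <= m] matters: subtraction truncates, so a larger [d] would count [interval n 0 m] again. *)
Lemma sum_last_tile n m (P : {set {set 'I_n}}) : 0 < m <= n ->
  P \in prefix_tilings n m ->
  \sum_(d < 4 | 0 < d <= m) (interval n (m - d) m \in P) = 1.
Proof.
move=> mn; rewrite inE => /andP[pP /forall_inP tP].
have lt_x : m.-1 < n by lia.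
pose x := Ordinal lt_x.
have tI : trivIset P by case/and3P: pP.
have xP : x \in cover P by rewrite (cover_partition pP) inE /=; lia.
have BP : pblock P x \in P by rewrite pblock_mem.
have [a [d [d13 adn defB]]] := tileP _ (tP _ BP).
have xB : x \in pblock P x by rewrite mem_pblock.
have ltd : d < 4 by lia.
have lad : (a + d).-1 < n by lia.
(* The last hexagon of the block stays in the prefix, so [a + d <= m]; the converse bound comes from
   [x] being in the block. *)
have : Ordinal lad \in interval n 0 m.
  rewrite -(cover_partition pP); apply/bigcupP; exists (pblock P x) => //.
  by rewrite defB inE /=; lia.
move: xB; rewrite defB !inE /= => xB yP.
have defm : m = a + d by lia.
rewrite (bigD1 (Ordinal ltd)) /=; last by lia.
have -> : m - d = a by lia.
rewrite defm -defB BP big1 // => e /andP[e0 ne_ed]; apply/eqP.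
rewrite eqb0; apply/negP=> CP.
have xC : x \in interval n (a + d - e) (a + d) by rewrite inE /=; lia.
have := def_pblock tI CP xC; rewrite defB => /setP eqB.
have la : a < n by lia.
have la' : a + d - e < n by lia.
(* Equal intervals contain each other's left ends, which forces [e = d]. *)
move: (eqB (Ordinal la)) (eqB (Ordinal la')) ne_ed.
by rewrite !inE /= -val_eqE /=; lia.
Qed.

Lemma card_prefix_tilings_rec n m : 0 < m <= n ->
  #|prefix_tilings n m| = \sum_(d < 4 | 0 < d <= m) #|prefix_tilings n (m - d)|.
Proof.
move=> mn; rewrite -sum1_card.
(* Double counting: each tiling is weighted by its unique last tile, then the sums are exchanged to
   group tilings by the length of that tile. *)
under eq_bigr => P PT do rewrite -(sum_last_tile mn PT).
rewrite exchange_big /=; apply: eq_bigr => d dm.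
have mdK : m - d + d = m by lia.
have d13 : 0 < d <= 3 by have := ltn_ord d; lia.
have mdn : m - d + d <= n by lia.
rewrite -(card_prefix_tilings_last d13 mdn) mdK.
by rewrite -sum1dep_card big_mkcondr; apply: eq_bigr => P _; case: ifP.
Qed.

Lemma card_prefix_tilings n m : m <= n ->
  #|prefix_tilings n m| = tribonacci m.+2.
Proof.
elim/ltn_ind: m => -[_ _|m IH mn].
  rewrite -[RHS](cards1 (set0 : {set {set 'I_n}})); apply: eq_card => P.
  have I0 : interval n 0 0 = set0 by apply/setP=> x; rewrite !inE; lia.
  rewrite !inE I0 partition_set0; case: eqP => // ->.
  by apply/forall_inP=> B; rewrite inE.
rewrite card_prefix_tilings_rec // big_mkcond !big_ord_recl big_ord0 /=.
(* For strips of one or two hexagons the sum has fewer than three terms; the missing ones match the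
   zero values of [tribonacci] at 0 and 1. *)
case: m IH mn => [|[|m]] IH mn; rewrite ?subSS ?subn0 /= !IH //=; lia.
Qed.

Theorem theorem8 (n : nat) : num_tilings n = tribonacci (n + 2).
Proof.
rewrite addn2 -(card_prefix_tilings (leqnn n)); apply: eq_card => P.
rewrite !inE; have -> // : interval n 0 n = [set: 'I_n].
by apply/setP=> x; rewrite !inE ltn_ord.
Qed.
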